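(* Suppose the semilinear assumptions (S1)-(S4) and the ODE-observer assumption (O) listed in the context hold. Consider the system $$w_t=\Lambda(x)w_x+F(x,w),\quad \dot X=f^0(X,v(0,t),t),\quad u(0,t)=g^0(X,v(0,t),t),\quad v(1,t)=U(t),$$ with measurement $Y(t)=u(1,t)$, and the observer $$\hat u_x(x,t)=\frac{f^u(x,\hat w(x,t))}{\lambda^u(x)},\qquad \hat v_t(x,t)=\hat\mu(x)\hat v_x(x,t)+\hat\nu(x)f^v(x,\hat w(x,t)),$$ $$\hat u(1,t)=Y(t),\quad \hat v(1,t)=U(t),\quad \hat w(\cdot,0)=\hat w_0,$$ $$\dot{\hat X}(t)=h(\hat X(t),\hat u(0,t),\hat v(0,t),\check\tau^u(t;0)),\quad \hat X(0)=\hat X_0,$$ where $\hat w=(\hat u,\hat v)^T$, $\hat\nu=\frac{\lambda^u}{\lambda^u+\lambda^v}$, $\hat\mu=\lambda^v\hat\nu$. Let $\check w(x,t)=w(x,\check\tau^u(t;x))$ and $\check X(t)=X(\check\tau^u(t;0))$. Then there exists $T>0$ such that for any initial guess $(\hat w_0,\hat X_0)$ and any $Y,U$ in $L^\infty$, we have $\hat w(\cdot,t)=\check w(\cdot,t)$ and $\hat X(t)=\check X(t)$ for all $t\ge T$.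
   Context: Notation: $w(x,t)=(u(x,t),v(x,t))^T\in\mathbb{R}^2$, $x\in[0,1]$, $t\ge0$; $X(t)\in\mathbb{R}^n$; initial data $w(\cdot,0)=w_0\in L^\infty$, $X(0)=X_0$; $U$ is the (known) control input; $\Lambda(x)=\mathrm{diag}(-\lambda^u(x),\lambda^v(x))$, $\lambda^u,\lambda^v>0$; $F=(f^u,f^v)^T$. Solutions are broad solutions in $L^\infty$, i.e. solutions of the integral equations obtained by integrating the PDE along its characteristic lines. Semilinear assumptions: (S1) $\Lambda$ does not depend on $w$, and $\sup_{x\in[0,1]}\max\{(\lambda^u(x))^{-1},(\lambda^v(x))^{-1}\}\le l_{\Lambda^{-1}}<\infty$. (S2) $F,f^0,g^0$ are globally Lipschitz in the state arguments: $\partial_wF(x,w)$ is essentially bounded over $x\in[0,1]$, $w\in\mathbb{R}^2$, and $\partial_Xf^0,\partial_vf^0,\partial_Xg^0,\partial_vg^0$ (at $(X,v,t)$) are essentially bounded over $X\in\mathbb{R}^n,v\in\mathbb{R},t\ge0$. (S3) $F(x,0)=0$ for all $x\in[0,1]$, and $f^0(0,0,t)=0$, $g^0(0,0,t)=0$ for all $t\ge0$. (S4) There exists a real-valued $K(X,t)$ with $\partial_XK$ essentially bounded over $X\in\mathbb{R}^n,t\ge0$, $K(0,t)=0$ for all $t\ge0$, such that $\dot X(t)=f^0(X(t),K(X(t),t),t)$ has a globally asymptotically stable equilibrium at the origin. ODE-observer assumption (O): $h$ is an observer for the ODE part of the system, i.e. the estimate $\hat X(t)$ satisfying $\dot{\hat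 X}(t)=h(\hat X(t),u(0,t),v(0,t),t)$, $\hat X(0)=\hat X_0$, converges to (becomes equal to) the actual value $X(t)$ within finite time for any initial guess $\hat X_0$, input signal $v(0,t)$ and output measurement $u(0,t)$. Past characteristic time: $\check\tau^u(t;x)=t-\int_x^1\frac{1}{\lambda^u(\xi)}d\xi$.
   Formalization: Assumption (O) is strengthened: the ODE observer must converge when started at any time t0 ≥ 0, not only at 0, within a finite time uniform over initial guesses, inputs and plant trajectories; with start time 0 only, the claim fails for some time-varying h. *)

(* Defs.v *)
From HB Require Import structures.
From mathcomp Require Export all_boot all_order all_algebra.
From mathcomp Require Export all_classical all_reals all_analysis.

Set Implicit Arguments.
Unset Strict Implicit.
Unset Printing Implicit Defensive.

Export Order.TTheory GRing.Theory Num.Theory.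
Export numFieldNormedType.Exports.

Local Open Scope classical_set_scope.
Local Open Scope ring_scope.

(** MathComp-Analysis, over an arbitrary [R : realType].  A profile is a map
    [x => (u x, v x)] and a state a map [x t => (u x t, v x t)]; only
    [0 <= x <= 1] and [0 <= t] are meaningful. *)

Section Defs.
Context {R : realType}.
Notation mu := (@lebesgue_measure R).

Definition integrable_on (a b : R) (f : R -> R) : Prop :=
  mu.-integrable `[a, b] (EFin \o f).

Definition integral_on (a b : R) (f : R -> R) : R :=
  \int[mu]_(s in `[a, b]) f s.

(** Elements of L^oo are given by bounded measurable representatives, so that
    traces at [x = 0, 1] and values along individual characteristic lines make
    sense and the integral equations can be required everywhere. *)
Definition Linf_profile (w0 : R -> R * R) : Prop :=
  measurable_fun (`[0, 1] : set R) w0 /\ [bounded w0 x | x in `[0, 1]].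

(** Signals and states are bounded on bounded time intervals only. *)
Definition Linf_signal (t0 : R) (U : R -> R) : Prop :=
  measurable_fun (`[t0, +oo[ : set R) U /\
  forall t1, [bounded U t | t in `[t0, t1]].

Definition Linf_state (w : R -> R -> R * R) : Prop :=
  measurable_fun (`[0, 1] `*` `[0, +oo[ : set (R * R)) (fun p : R * R => w p.1 p.2) /\
  forall t1, [bounded w p.1 p.2 | p in `[0, 1] `*` `[0, t1]].

(** ** Characteristics and broad solutions *)

(** Time needed to travel from [a] to [b] at speed [c]. *)
Definition transit (c : R -> R) (a b : R) : R :=
  integral_on a b (fun xi => (c xi)^-1).

(** Broad solutions of [z_t = - c(x) z_x + g(x,t)], [c > 0].  The line
    [dx/dt = c(x)] through [(x, t)] is parametrized by the position [xi], its
    time coordinate being [t - transit c xi x].  The integral equation is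
    required on every piece of the line lying in [0 <= x <= 1], [0 <= t]; the
    foot of the line is then on [x = 0] or on [t = 0]. *)
Definition broad_rightward (c : R -> R) (z g : R -> R -> R) : Prop :=
  forall y x t, 0 <= y -> y <= x -> x <= 1 -> 0 <= t - transit c y x ->
    let G xi := g xi (t - transit c xi x) / c xi in
    integrable_on y x G /\
    z x t = z y (t - transit c y x) + integral_on y x G.

(** Likewise for [z_t = c(x) z_x + g(x,t)], [c > 0]. *)
Definition broad_leftward (c : R -> R) (z g : R -> R -> R) : Prop :=
  forall x y t, 0 <= x -> x <= y -> y <= 1 -> 0 <= t - transit c x y ->
    let G xi := g xi (t - transit c x xi) / c xi in
    integrable_on x y G /\
    z x t = z y (t - transit c x y) + integral_on x y G.

(** Caratheodory solutions of [X' = f(t, X)] on [[t0, +oo[]. *)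
Definition ode_solution n (t0 : R) (f : R -> 'rV[R]_n -> 'rV[R]_n)
    (X : R -> 'rV[R]_n) : Prop :=
  forall t, t0 <= t -> forall i,
    integrable_on t0 t (fun s => f s (X s) 0 i) /\
    X t 0 i = X t0 0 i + integral_on t0 t (fun s => f s (X s) 0 i).

(** ** Assumptions *)

(** Measurability is what gives the travel times a meaning. *)
Definition admissible_speeds (lu lv : R -> R) : Prop :=
  [/\ measurable_fun (`[0, 1] : set R) lu, measurable_fun (`[0, 1] : set R) lv,
      forall x, 0 <= x <= 1 -> 0 < lu x /\ 0 < lv x
    & exists l, forall x, 0 <= x <= 1 -> Num.max (lu x)^-1 (lv x)^-1 <= l].

(** Global Lipschitz continuity in the state, with one constant for almost
    every value of the parameter [s] in [D]: an essentially bounded derivative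
    with respect to the state. *)
Definition ess_lipschitz (V W : normedModType R) (D : set R) (f : R -> V -> W)
    : Prop :=
  exists L : R, \forall s \ae mu, D s -> L.-lipschitz (f s).

Definition lipschitz_data n (F : R -> R * R -> R * R)
    (f0 : 'rV[R]_n -> R -> R -> 'rV[R]_n) (g0 : 'rV[R]_n -> R -> R -> R)
    : Prop :=
  [/\ ess_lipschitz `[0, 1] F,
      ess_lipschitz `[0, +oo[ (fun t (p : 'rV[R]_n * R) => f0 p.1 p.2 t)
    & ess_lipschitz `[0, +oo[ (fun t (p : 'rV[R]_n * R) => g0 p.1 p.2 t)].

Definition zero_equilibrium n (F : R -> R * R -> R * R)
    (f0 : 'rV[R]_n -> R -> R -> 'rV[R]_n) (g0 : 'rV[R]_n -> R -> R -> R)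
    : Prop :=
  (forall x, 0 <= x <= 1 -> F x 0 = 0) /\
  (forall t, 0 <= t -> f0 0 0 t = 0 /\ g0 0 0 t = 0).

(** Global asymptotic stability of the origin for a time-varying ODE: Lyapunov
    stability and global attractivity from every initial time, not required to
    be uniform in the initial time. *)
Definition globally_asymptotically_stable n (f : R -> 'rV[R]_n -> 'rV[R]_n)
    : Prop :=
  [/\ forall t, 0 <= t -> f t 0 = 0,
      forall t0 e, 0 <= t0 -> 0 < e -> exists2 d, 0 < d &
        forall X, ode_solution t0 f X -> `|X t0| < d ->
          forall t, t0 <= t -> `|X t| < e
    & forall t0 X, 0 <= t0 -> ode_solution t0 f X ->
        X t @[t --> +oo] --> (0 : 'rV[R]_n)].

Definition stabilizable n (f0 : 'rV[R]_n -> R -> R -> 'rV[R]_n) : Prop :=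
  exists K : 'rV[R]_n -> R -> R,
    [/\ ess_lipschitz `[0, +oo[ (fun t X => K X t : R),
        forall t, 0 <= t -> K 0 t = 0
      & globally_asymptotically_stable (fun t X => f0 X (K X t) t)].

(** [h] is a finite-time observer for [X' = f0(X,v,t)] with input [v] and
    output [u = g0(X,v,t)].  The system being time-varying, the observer may be
    started at any time [t0 >= 0].  The convergence time [d] may depend on [t0],
    but not on the signals, the plant trajectory or the initial guess. *)
Definition ode_observer n (f0 : 'rV[R]_n -> R -> R -> 'rV[R]_n)
    (g0 : 'rV[R]_n -> R -> R -> R) (h : 'rV[R]_n -> R -> R -> R -> 'rV[R]_n)
    : Prop :=
  forall t0, 0 <= t0 -> exists2 d, 0 <= d &
    forall (u v : R -> R) (X Xhat : R -> 'rV[R]_n),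
      Linf_signal t0 v ->
      ode_solution t0 (fun t Z => f0 Z (v t) t) X ->
      (forall t, t0 <= t -> u t = g0 (X t) (v t) t) ->
      ode_solution t0 (fun t Z => h Z (u t) (v t) t) Xhat ->
      forall t, t0 + d <= t -> Xhat t = X t.

(** ** System, observer and delayed state *)

(** Initial profiles are prescribed almost everywhere, i.e. in L^oo, so that no
    compatibility with the boundary values at [(0,0)] and [(1,0)] is imposed. *)
Definition system_solution n (lu lv : R -> R) (F : R -> R * R -> R * R)
    (f0 : 'rV[R]_n -> R -> R -> 'rV[R]_n) (g0 : 'rV[R]_n -> R -> R -> R)
    (w0 : R -> R * R) (X0 : 'rV[R]_n) (U Y : R -> R)
    (w : R -> R -> R * R) (X : R -> 'rV[R]_n) : Prop :=
  let u x t := (w x t).1 in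
  let v x t := (w x t).2 in
  [/\ Linf_state w,
      broad_rightward lu u (fun x t => (F x (w x t)).1) /\
      broad_leftward lv v (fun x t => (F x (w x t)).2),
      ode_solution 0 (fun t Z => f0 Z (v 0 t) t) X,
      forall t, 0 <= t ->
        [/\ u 0 t = g0 (X t) (v 0 t) t, v 1 t = U t & Y t = u 1 t]
    & (\forall x \ae mu, 0 <= x <= 1 -> w x 0 = w0 x) /\ X 0 = X0].

(** Time at which the [u]-characteristic reaching [x = 1] at time [t] passes
    through [x]. *)
Definition past_time (lu : R -> R) (t x : R) : R := t - transit lu x 1.

Definition delayed_state (lu : R -> R) (w : R -> R -> R * R) (x t : R)
    : R * R := w x (past_time lu t x).

Definition delayed_ode n (lu : R -> R) (X : R -> 'rV[R]_n) (t : R)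
    : 'rV[R]_n := X (past_time lu t 0).

Definition nuhat (lu lv : R -> R) (x : R) : R := lu x / (lu x + lv x).
Definition muhat (lu lv : R -> R) (x : R) : R := lv x * nuhat lu lv x.

(** The equation [u_x = f^u / lambda^u] has no time derivative: it is imposed
    for [t > 0], integrated from [x = 1], so that the initial guess of the first
    component is unconstrained. *)
Definition observer_solution n (lu lv : R -> R) (F : R -> R * R -> R * R)
    (h : 'rV[R]_n -> R -> R -> R -> 'rV[R]_n)
    (what0 : R -> R * R) (Xhat0 : 'rV[R]_n) (U Y : R -> R)
    (what : R -> R -> R * R) (Xhat : R -> 'rV[R]_n) : Prop :=
  let uhat x t := (what x t).1 in
  let vhat x t := (what x t).2 in
  let G t x := (F x (what x t)).1 / lu x in
  [/\ Linf_state what,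
      (forall x t, 0 <= x <= 1 -> 0 < t ->
        integrable_on x 1 (G t) /\
        uhat x t = uhat 1 t - integral_on x 1 (G t)) /\
      broad_leftward (muhat lu lv) vhat
        (fun x t => nuhat lu lv x * (F x (what x t)).2),
      ode_solution 0
        (fun t Z => h Z (uhat 0 t) (vhat 0 t) (past_time lu t 0)) Xhat,
      forall t, 0 <= t -> uhat 1 t = Y t /\ vhat 1 t = U t
    & (\forall x \ae mu, 0 <= x <= 1 -> what x 0 = what0 x) /\ Xhat 0 = Xhat0].

End Defs.

(* Main.v *)
Require Import Defs.
From mathcomp Require Import measurable_realfun.
From mathcomp Require Import ring lra.

Set Implicit Arguments.
Unset Strict Implicit.
Unset Printing Implicit Defensive.

Local Open Scope classical_set_scope.
Local Open Scope ring_scope.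

(** The observer is the plant read along its outgoing characteristics.  Put
    [wc x t := delayed_state lu w x t], the plant state at the moment when the
    [u]-characteristic that leaves the domain at time [t] passes through [x].

    In these coordinates a [u]-characteristic is a line [t = constant], so the
    integral equation for [u] becomes [uc x t = Y t - int_x^1 f^u / lu]: this is
    the first observer equation ([rightward_past]).  Going back along a
    [v]-characteristic from [x] to [1] costs the travel time at speed [lv] plus
    the change of delay, the travel time at speed [lu]; since
    [(muhat)^-1 = lu^-1 + lv^-1] this total is the travel time at speed [muhat],
    and [vc] satisfies the second observer equation ([leftward_past]).  Thus
    [wc] and [what] obey the same equations with the same data [Y], [U] at
    [x = 1], as long as the characteristic to [x = 1] does not reach back before
    time [0], that is for [t >= transit muhat x 1].

    On that region the error [e = |what - wc|] satisfies a Volterra inequality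
    in space: [e(x,.)] is at most a constant times the integral over [[x, 1]] of
    [e] along a characteristic, and the region contains these characteristics.
    In the norm weighted by [expR (k * (1 - x))] with [k] large the right-hand
    side is a contraction of factor [1/2] ([source_integral_contraction]); as
    [e] is bounded, it vanishes ([halving_le0], [observer_state_eq]).

    From then on the observer ODE is driven by the true boundary values delayed
    by [transit lu 0 1]; after a translation of time it is the ODE observer of
    the plant, started at a time that depends only on the speeds, so it
    converges after a further delay that depends only on this starting time. *)

(** * Integrals over segments *)

Section Integrals.
Context {R : realType}.
Notation mu := (@lebesgue_measure R).
Implicit Types f g : R -> R.

Lemma integrable_on_sub f a b a' b' : a <= a' -> b' <= b ->
  integrable_on a b f -> integrable_on a' b' f.
Proof.
move=> aa' b'b; apply: integrableS => //.
by apply: subset_itv; rewrite bnd_simp.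
Qed.

Lemma eq_integral_on f g a b : (forall s, a <= s <= b -> f s = g s) ->
  integral_on a b f = integral_on a b g.
Proof.
by move=> fg; apply: eq_Rintegral => s; rewrite inE/= in_itv/=; exact: fg.
Qed.

Lemma eq_integrable_on f g a b : (forall s, a <= s <= b -> f s = g s) ->
  integrable_on a b f -> integrable_on a b g.
Proof.
move=> fg; apply: eq_integrable => // s; rewrite inE/= in_itv/= => sab.
by rewrite /= fg.
Qed.

Lemma integral_on_split f a b c : a <= b -> b <= c -> integrable_on a c f ->
  integral_on a c f = integral_on a b f + integral_on b c f.
Proof.
move=> ab bc fi; rewrite /integral_on.
rewrite -(@Rintegral_itv_obnd_cbnd _ b); last first.
  by apply: integrableS fi => //; apply: subset_itv; rewrite bnd_simp.
by rewrite -(Rintegral_itvB fi) ?bnd_simp// addrC subrK.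
Qed.

(** The bound holds almost everywhere only because the Lipschitz condition on the
    source terms excludes a null set of positions. *)
Lemma integral_on_diff_le f1 f2 g a b :
  integrable_on a b f1 -> integrable_on a b f2 -> integrable_on a b g ->
  (forall s, a <= s <= b -> 0 <= g s) ->
  (\forall s \ae mu, a <= s <= b -> `|f1 s - f2 s| <= g s) ->
  `|integral_on a b f1 - integral_on a b f2| <= integral_on a b g.
Proof.
move=> if1 if2 ig g0 dg.
rewrite /integral_on -RintegralB//.
have i12 : mu.-integrable `[a, b] (EFin \o (fun s => f1 s - f2 s)).
  by apply: (integrableB _ if1 if2); exact: measurable_itv.
apply: (le_trans (le_normr_Rintegral _ i12)) => //.
rewrite /Rintegral fine_le//.
- have := integrable_norm i12 => /integrable_fin_num; exact.
- exact: integrable_fin_num.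
- apply: ae_ge0_le_integral => //.
  + exact: (measurable_int mu (integrable_norm i12)).
  + exact: (measurable_int mu ig).
Qed.

(** Why the error is measured against [expR (k * (1 - s))]: integrating this
    weight over [[x, 1]] gains a factor [k^-1].  The factor [k] in [f] keeps the
    identity meaningful for [k = 0]. *)
Lemma integral_on_expR (k x : R) : x <= 1 ->
  let f s := k * expR (k * (1 - s)) in
  integrable_on x 1 f /\ integral_on x 1 f = expR (k * (1 - x)) - 1.
Proof.
move=> x1 f.
have cf : continuous (f : R^o -> R^o).
  move=> s; apply: cvgM; first exact: cvg_cst.
  apply: continuous_comp; last exact: continuous_expR.
  apply: cvgM; first exact: cvg_cst.
  by apply: cvgB; [exact: cvg_cst|exact: cvg_id].
have fi : integrable_on x 1 f.
  apply: continuous_compact_integrable; first exact: segment_compact.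
  exact: continuous_subspaceT.
split=> //.
move: x1; rewrite le_eqVlt => /predU1P[->|x1].
  by rewrite /integral_on set_itv1 Rintegral_set1 subrr mulr0 expR0 subrr.
have dF (s : R) : is_derive s 1 (fun s : R => - expR (k * (1 - s))) (f s).
  apply: is_derive_eq; rewrite /f.
  by rewrite /GRing.scale/=; ring.
have cF : continuous (fun s : R => - expR (k * (1 - s))).
  move=> s; apply: differentiable_continuous; apply/derivable1_diffP.
  exact: ex_derive.
rewrite /integral_on /Rintegral.
rewrite (@continuous_FTC2 _ f (fun s => - expR (k * (1 - s))))//=.
- rewrite subrr mulr0 expR0; ring.
- exact: continuous_subspaceT.
- split.
  + by move=> z _; exact: ex_derive.
  + by apply/cvg_at_right_filter; exact: cF.
  + by apply/cvg_at_left_filter; exact: cF.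
- by move=> z _; rewrite derive1E; apply: derive_val.
Qed.

(** Lebesgue measure is its own image under a translation, because the two agree
    on half-open intervals. *)
Lemma integral_on_shift f (a b c : R) : integrable_on (a + c) (b + c) f ->
  integrable_on a b (fun s => f (s + c)) /\
  integral_on a b (fun s => f (s + c)) = integral_on (a + c) (b + c) f.
Proof.
move=> fi.
pose D : set (measurableTypeR R) := [set` `[a + c, b + c]].
pose phi (s : measurableTypeR R) : measurableTypeR R := s + c.
have mphi : measurable_fun setT phi by apply: measurable_funD.
have mD : measurable D by exact: measurable_itv.
have phiD : phi @^-1` D = [set` `[a, b]].
  by apply/seteqP; split => s; rewrite /D /= !in_itv/= !lerD2r.
have push A : measurable A -> mu A = pushforward mu phi A.
  move: A; apply: lebesgue_measure_unique => _ [[x y]] _ <-.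
  have -> : mu [set` `]x, y]] = mu [set` `]x - c, y - c]].
    rewrite !lebesgue_measure_itv/= !lte_fin ltrD2r.
    by case: ifP => // _; rewrite -!EFinB; congr (_%:E); ring.
  rewrite /pushforward; congr (mu _); apply/seteqP; split => s;
  by rewrite /= !in_itv/= /phi ltrBlDr lerBrDr.
(* Extended by zero, the integrand is measurable on the whole line, as the
   formula for integrals against an image measure requires. *)
pose g : measurableTypeR R -> \bar R := (EFin \o f) \_ D.
have mf := measurable_int mu fi.
have mg : measurable_fun setT g by exact/(measurable_restrictT _ mD).
have gphi : {in `[a, b]%classic, (g \o phi) =1 (EFin \o (fun s => f (s + c)))}.
  by move=> s; rewrite -phiD inE => sD; rewrite /g /= patchE mem_set.
have gi : mu.-integrable (phi @^-1` D) (g \o phi).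
  apply/integrableP; split.
    by apply: measurable_funTS; exact: measurableT_comp.
  rewrite -(@ge0_integral_pushforward _ _ _ _ _ phi mphi mu D
    (fun s => `|g s|%E))//; last first.
    by apply: measurable_funTS; exact: measurableT_comp.
  rewrite (eq_measure_integral mu); last first.
    by move=> A mA _; exact: (esym (push A mA)).
  move/integrableP : fi => [_]; apply: le_lt_trans.
  by under eq_integral => s sD do rewrite /g patchE sD.
have ifc : integrable_on a b (fun s => f (s + c)).
  rewrite /integrable_on; apply: (@eq_integrable _ _ R mu _ _ (g \o phi)).
  - exact: measurable_itv.
  - exact: gphi.
  - by rewrite -phiD.
split=> //.
rewrite /integral_on /Rintegral; congr fine.
transitivity (\int[mu]_(s in phi @^-1` D) (g \o phi) s)%E.
  by rewrite phiD; apply: eq_integral => s /gphi ->.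
rewrite -(@integral_pushforward _ _ _ _ _ phi mphi mu D g)//.
transitivity (\int[mu]_(s in D) g s)%E.
  by apply: eq_measure_integral => A mA _; exact: (esym (push A mA)).
by apply: eq_integral => s sD; rewrite /g patchE sD.
Qed.

End Integrals.

(** * Restarting and translating solutions of an ODE *)

Section Ode.
Context {R : realType} {n : nat}.
Implicit Types (f g : R -> 'rV[R]_n -> 'rV[R]_n) (X : R -> 'rV[R]_n).

Lemma ode_solution_restart f X t0 t1 : t0 <= t1 ->
  ode_solution t0 f X -> ode_solution t1 f X.
Proof.
move=> t01 odeX t t1t i.
have [fi Xt] := odeX t (le_trans t01 t1t) i.
have [_ Xt1] := odeX t1 t01 i.
split; first exact: integrable_on_sub fi.
by rewrite Xt Xt1 (integral_on_split t01 t1t fi) addrA.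
Qed.

Lemma ode_solution_shift f X t0 c : ode_solution (t0 + c) f X ->
  ode_solution t0 (fun t => f (t + c)) (fun t => X (t + c)).
Proof.
move=> odeX t t0t i.
have [|fi Xt] := odeX (t + c) _ i; first by rewrite lerD2r.
have [fci fcE] := integral_on_shift fi.
by split=> //; rewrite Xt fcE.
Qed.

Lemma eq_ode_solution f g X t0 : (forall t, t0 <= t -> f t (X t) = g t (X t)) ->
  ode_solution t0 f X -> ode_solution t0 g X.
Proof.
move=> fg odeX t t0t i; have [fi Xt] := odeX t t0t i.
have fgi s : t0 <= s <= t -> f s (X s) 0 i = g s (X s) 0 i.
  by move=> /andP[t0s _]; rewrite fg.
split; first exact: eq_integrable_on fi.
by rewrite Xt (eq_integral_on fgi).
Qed.

End Ode.

(** * Bounded functions and contractions *)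

Section Bounded.
Context {R : realType}.

Lemma bounded_onP {T : Type} {V : normedModType R} (A : set T) (f : T -> V) :
  [bounded f x | x in A] <-> exists M, forall x, A x -> `|f x| <= M.
Proof.
split=> [[M [_ fM]]|[M fM]].
  by exists (M + 1); apply: fM; rewrite ltrDl.
exists M; split=> [|N MN x Ax]; first exact: num_real.
exact/(le_trans (fM _ Ax))/ltW.
Qed.

Lemma Linf_signal_trace (w : R -> R -> R * R) x t0 : 0 <= x <= 1 -> 0 <= t0 ->
  Linf_state w -> Linf_signal t0 (fun t => (w x t).2).
Proof.
move=> x01 t00 [mw bw]; split.
  have mwx : measurable_fun (`[t0, +oo[ : set R)
      ((fun p : R * R => w p.1 p.2) \o pair x).
    apply: measurable_comp mw _.
  - by apply: measurableX.
  - move=> _ [t /= + <-]; rewrite in_itv/= andbT => t0t; split=> //=.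
    by rewrite in_itv/= andbT (le_trans t00).
  - by apply: measurable_funTS; exact: pair1_measurable.
  exact: (measurableT_comp measurable_snd mwx).
move=> t1; have /bounded_onP[M wM] := bw t1; apply/bounded_onP; exists M.
move=> t; rewrite /= in_itv/= => /andP[t0t tt1].
apply: (le_trans _ (wM (x, t) _)); last first.
  by split; rewrite /= in_itv//= tt1 (le_trans t00).
by rewrite /= prod_normE/= le_max lexx orbT.
Qed.

(** A bound proportional to [r] that can be halved forever is [0]: this is
    uniqueness of the fixed point of a contraction, for the norm
    [sup (e / r)]. *)
Lemma halving_le0 (T : Type) (D : set T) (e r : T -> R) (M : R) : 0 <= M ->
  (forall z, D z -> e z <= M * r z) ->
  (forall A, 0 <= A -> (forall z, D z -> e z <= A * r z) ->
    forall z, D z -> e z <= A / 2 * r z) ->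
  forall z, D z -> e z <= 0.
Proof.
move=> M0 eM half z Dz.
have bound m : forall y, D y -> e y <= M / 2 ^+ m * r y.
  elim: m => [|m IH]; first by rewrite expr0 divr1.
  have -> : M / 2 ^+ m.+1 = (M / 2 ^+ m) / 2.
    by rewrite exprSr invfM mulrA.
  by apply: half => //; rewrite divr_ge0// exprn_ge0.
rewrite leNgt; apply/negP => ez.
have [m hm] : exists m : nat, M * r z < m%:R * e z.
  exists (Num.trunc (M * r z / e z)).+1.
  by rewrite -ltr_pdivrMr// truncnS_gt.
have := bound m _ Dz; rewrite mulrAC ler_pdivlMr ?exprn_gt0// leNgt.
move=> /negP; apply; apply: (lt_le_trans hm); rewrite mulrC ler_pM2l//.
by rewrite -natrX ler_nat ltnW// ltn_expl.
Qed.

End Bounded.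

(** * Travel times *)

Section Transit.
Context {R : realType}.
Notation mu := (@lebesgue_measure R).
Implicit Types c : R -> R.

Definition slowness_bounded (l : R) c :=
  measurable_fun (`[0, 1] : set R) c /\
  forall x, 0 <= x <= 1 -> 0 < c x /\ (c x)^-1 <= l.

Lemma slowness_bound_ge0 l c : slowness_bounded l c -> 0 <= l.
Proof.
move=> [_ /(_ 0)[]]; first by rewrite lexx ler01.
by move=> c0; apply: le_trans; rewrite invr_ge0 ltW.
Qed.

Lemma integrable_slowness l c x y : slowness_bounded l c ->
  0 <= x -> y <= 1 -> integrable_on x y (fun xi => (c xi)^-1).
Proof.
move=> [mc cl] x0 y1.
apply: (@integrable_on_sub _ _ 0 1) => //.
apply: measurable_bounded_integrable.
- exact: measurable_itv.
- by rewrite /= lebesgue_measure_itv/= lte_fin ltr01 -EFinB ltry.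
- apply: (@eq_measurable_fun _ _ _ _ _ ((fun x => powR x (-1)) \o c)).
    move=> s; rewrite inE/= in_itv/= => /cl[cs _].
    by rewrite powR_inv1// ltW.
  by apply: measurableT_comp => //; exact: measurable_powR.
- apply/bounded_onP; exists l => s /=; rewrite in_itv/= => /cl[cs].
  by rewrite ger0_norm// invr_ge0 ltW.
Qed.

Lemma transit_ge0 l c x y : slowness_bounded l c -> 0 <= x -> y <= 1 ->
  0 <= transit c x y.
Proof.
move=> [_ cl] x0 y1; apply: Rintegral_ge0 => s /=; rewrite in_itv/=.
move=> /andP[xs sy]; rewrite invr_ge0 ltW//; apply: (cl s _).1.
by rewrite (le_trans x0)//= (le_trans sy).
Qed.

Lemma transit_split l c x y z : slowness_bounded l c ->
  0 <= x -> x <= y -> y <= z -> z <= 1 ->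
  transit c x z = transit c x y + transit c y z.
Proof.
move=> lc x0 xy yz z1; apply: integral_on_split => //.
exact: integrable_slowness lc _ _.
Qed.

Lemma transit1 c : transit c 1 1 = 0.
Proof. by rewrite /transit /integral_on set_itv1 Rintegral_set1. Qed.

(** [(muhat)^-1 = lu^-1 + lv^-1]. *)
Lemma transit_muhat l lu lv x y :
  slowness_bounded l lu -> slowness_bounded l lv -> 0 <= x -> y <= 1 ->
  transit (muhat lu lv) x y = transit lu x y + transit lv x y.
Proof.
move=> slu slv x0 y1.
rewrite /transit /integral_on -RintegralD//; last 2 first.
  exact: integrable_slowness slu _ _.
  exact: integrable_slowness slv _ _.
apply: eq_integral_on => s /andP[xs sy].
have s01 : 0 <= s <= 1 by rewrite (le_trans x0)//= (le_trans sy).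
have [lus _] := slu.2 s s01; have [lvs _] := slv.2 s s01.
rewrite /muhat /nuhat; field.
by rewrite !gt_eqF//= addr_gt0.
Qed.

(** Moving along a [v]-characteristic changes both the time and the delay; the
    two changes add up to a travel time at speed [muhat], which is why the
    observer transports [vhat] at that speed. *)
Lemma past_time_muhat l lu lv t x xi :
  slowness_bounded l lu -> slowness_bounded l lv ->
  0 <= x -> x <= xi -> xi <= 1 ->
  past_time lu t x - transit lv x xi =
  past_time lu (t - transit (muhat lu lv) x xi) xi.
Proof.
move=> slu slv x0 xxi xi1.
rewrite /past_time (transit_muhat slu slv)// (transit_split slu x0 xxi xi1)//.
ring.
Qed.

End Transit.

(** * Contraction of the tracking error *)

Section Contraction.
Context {R : realType}.
Notation mu := (@lebesgue_measure R).

Lemma normB_fst_le (a b : R * R) : `|a.1 - b.1| <= `|a - b|.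
Proof. by rewrite [leRHS]prod_normE/= le_max lexx. Qed.

Lemma normB_snd_le (a b : R * R) : `|a.2 - b.2| <= `|a - b|.
Proof. by rewrite [leRHS]prod_normE/= le_max lexx orbT. Qed.

(** The integrands differ by at most [|L| * l = k / 2] times the error, and
    integrating the weight divides it by [k], whence the factor [1 / 2].  The
    1-Lipschitz map [p] stands for either projection. *)
Lemma source_integral_contraction (F : R -> R * R -> R * R) (L l : R)
    (c : R -> R) (p : R * R -> R) (z1 z2 : R -> R * R) (x A : R) :
  (\forall s \ae mu, `[0, 1]%classic s -> L.-lipschitz (F s)) ->
  slowness_bounded l c ->
  (forall a b, `|p a - p b| <= `|a - b|) ->
  0 <= x <= 1 -> 0 <= A ->
  let k := 2 * (`|L| * l) in
  let G z s := p (F s (z s)) / c s in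
  integrable_on x 1 (G z1) -> integrable_on x 1 (G z2) ->
  (forall s, x <= s <= 1 -> `|z1 s - z2 s| <= A * expR (k * (1 - s))) ->
  `|integral_on x 1 (G z1) - integral_on x 1 (G z2)|
    <= A / 2 * expR (k * (1 - x)).
Proof.
move=> FL lc pL /andP[x0 x1] A0 k G iG1 iG2 z12.
have l0 := slowness_bound_ge0 lc.
have k0 : 0 <= k by rewrite !mulr_ge0.
have [ie ieE] := integral_on_expR k x1.
pose g s := A / 2 * (k * expR (k * (1 - s))).
have ig : integrable_on x 1 g.
  by apply: (integrableZl _ (A / 2) ie); exact: measurable_itv.
apply: (@le_trans _ _ (integral_on x 1 g)).
  apply: integral_on_diff_le => //.
    by move=> s _; rewrite !mulr_ge0// ?expR_ge0// invr_ge0.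
  apply: (@filterS _ _ (ae_filter_ringOfSetsType mu) _ _ _ FL).
  move=> s FLs /andP[xs s1].
  have s01 : 0 <= s <= 1 by rewrite (le_trans x0 xs) s1.
  have [cs csl] := lc.2 s s01.
  have cV0 : 0 <= (c s)^-1 by rewrite invr_ge0 ltW.
  rewrite /G -mulrBl normrM (ger0_norm cV0).
  have FLs' : `|F s (z1 s) - F s (z2 s)| <= `|L| * `|z1 s - z2 s|.
    have := FLs _ (z1 s, z2 s); rewrite /= in_itv/= s01 => /(_ isT) h.
    by apply: (le_trans (h _)) => //; rewrite ler_wpM2r// ler_norm.
  apply: (@le_trans _ _ (`|L| * (A * expR (k * (1 - s))) * l)).
    apply: ler_pM => //.
    apply: (le_trans (pL _ _)); apply: (le_trans FLs').
    by rewrite ler_wpM2l// z12// xs.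
  by rewrite le_eqVlt; apply/orP; left; apply/eqP; rewrite /g /k; field.
have -> : integral_on x 1 g = A / 2 * (expR (k * (1 - x)) - 1).
  by rewrite -ieE /integral_on -RintegralZl.
by rewrite ler_wpM2l ?divr_ge0// gerBl.
Qed.

End Contraction.

(** * The delayed state solves the observer equations *)

Section Tracking.
Context {R : realType}.
Context (l : R) (lu lv : R -> R).
Context (slu : slowness_bounded l lu) (slv : slowness_bounded l lv).

Local Notation mh := (muhat lu lv).

Lemma transit_mh_ge0 x y : 0 <= x -> y <= 1 -> 0 <= transit mh x y.
Proof.
move=> x0 y1; rewrite (transit_muhat slu slv)// addr_ge0//.
  exact: transit_ge0 slu _ _.
exact: transit_ge0 slv _ _.
Qed.

Lemma transit_mh_split x y z : 0 <= x -> x <= y -> y <= z -> z <= 1 ->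
  transit mh x z = transit mh x y + transit mh y z.
Proof.
move=> x0 xy yz z1.
have y0 := le_trans x0 xy; have y1 := le_trans yz z1.
rewrite !(transit_muhat slu slv)//.
rewrite (transit_split slu x0 xy yz z1) (transit_split slv x0 xy yz z1).
ring.
Qed.

Lemma past_time_ge0 x t : 0 <= x <= 1 -> transit mh x 1 <= t ->
  0 <= past_time lu t x.
Proof.
move=> /andP[x0 x1]; rewrite (transit_muhat slu slv)// => xt.
rewrite subr_ge0 (le_trans _ xt)// lerDl.
exact: transit_ge0 slv _ _.
Qed.

(** Along [s |-> past_time lu t s] the observer time [t] is constant: the
    delayed first component solves an equation in [x] alone. *)
Lemma rightward_past (z g : R -> R -> R) x t :
  broad_rightward lu z g -> 0 <= x <= 1 -> transit lu x 1 <= t ->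
  let G s := g s (past_time lu t s) / lu s in
  integrable_on x 1 G /\
  z x (past_time lu t x) = z 1 t - integral_on x 1 G.
Proof.
move=> bz /andP[x0 x1] xt.
have [|iG zE] := bz x 1 t x0 x1 (lexx 1); first by rewrite subr_ge0.
by split=> //; rewrite zE addrK.
Qed.

(** The conclusion is the integral equation of [leftward_observer], written for
    the delayed second component. *)
Lemma leftward_past (z g : R -> R -> R) x t :
  broad_leftward lv z g -> 0 <= x <= 1 -> transit mh x 1 <= t ->
  let G s := g s (past_time lu (t - transit mh x s) s) / lv s in
  integrable_on x 1 G /\
  z x (past_time lu t x) = z 1 (t - transit mh x 1) + integral_on x 1 G.
Proof.
move=> bz /andP[x0 x1] xt G.
have pt s : x <= s <= 1 ->
    past_time lu t x - transit lv x s = past_time lu (t - transit mh x s) s.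
  by move=> /andP[xs s1]; exact: past_time_muhat slu slv x0 xs s1.
have pt1 : past_time lu t x - transit lv x 1 = t - transit mh x 1.
  by rewrite pt ?x1 ?lexx// /past_time transit1 subr0.
have [|iG zE] := bz x 1 (past_time lu t x) x0 x1 (lexx 1).
  by rewrite pt1 subr_ge0.
have GE s : x <= s <= 1 ->
    g s (past_time lu t x - transit lv x s) / lv s = G s.
  by move=> xs1; rewrite pt.
split; first exact: eq_integrable_on iG.
by rewrite zE pt1 (eq_integral_on GE).
Qed.

(** The factor [nuhat] cancels because [nuhat / muhat = lv^-1]. *)
Lemma leftward_observer (z g : R -> R -> R) x t :
  broad_leftward mh z (fun x t => nuhat lu lv x * g x t) ->
  0 <= x <= 1 -> transit mh x 1 <= t ->
  let G s := g s (t - transit mh x s) / lv s in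
  integrable_on x 1 G /\
  z x t = z 1 (t - transit mh x 1) + integral_on x 1 G.
Proof.
move=> bz /andP[x0 x1] xt G.
have [|iG zE] := bz x 1 t x0 x1 (lexx 1); first by rewrite subr_ge0.
have GE s : x <= s <= 1 ->
    nuhat lu lv s * g s (t - transit mh x s) / mh s = G s.
  move=> /andP[xs s1].
  have s01 : 0 <= s <= 1 by rewrite (le_trans x0).
  have [lus _] := slu.2 s s01; have [lvs _] := slv.2 s s01.
  rewrite /G /muhat /nuhat; field.
  by rewrite !gt_eqF//= addr_gt0.
split; first exact: eq_integrable_on iG.
by rewrite zE (eq_integral_on GE).
Qed.

Lemma observer_state_eq n (F : R -> R * R -> R * R)
    (f0 : 'rV[R]_n -> R -> R -> 'rV[R]_n) (g0 : 'rV[R]_n -> R -> R -> R)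
    (h : 'rV[R]_n -> R -> R -> R -> 'rV[R]_n)
    U Y what0 Xhat0 w0 X0 w what X Xhat :
  ess_lipschitz `[0, 1] F ->
  system_solution lu lv F f0 g0 w0 X0 U Y w X ->
  observer_solution lu lv F h what0 Xhat0 U Y what Xhat ->
  forall x t, 0 <= x <= 1 -> transit mh x 1 < t ->
    what x t = delayed_state lu w x t.
Proof.
move=> [L FL] [[_ bw] [bu bv] _ bc _] [[_ bwh] [ou ov] _ obc _] x1 t1 x1P x1t1.
(* The margin [d] keeps every time in [D] positive, where the equation for
   [uhat] is imposed; [D] contains the characteristics from its points to
   [x = 1]. *)
pose d := t1 - transit mh x1 1.
have d0 : 0 < d by rewrite subr_gt0.
pose D : set (R * R) := [set p |
  [/\ 0 <= p.1 <= 1, transit mh p.1 1 + d <= p.2 & p.2 <= t1]].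
have Dgt0 x t : D (x, t) -> 0 < t.
  move=> [/= /andP[x0 _] xt _]; apply: lt_le_trans xt.
  by rewrite ltr_wpDl// transit_mh_ge0.
have Dge x t : D (x, t) -> transit mh x 1 <= t.
  by move=> [_ /= xt _]; apply: le_trans xt; rewrite lerDl ltW.
pose e (p : R * R) := `|what p.1 p.2 - delayed_state lu w p.1 p.2|.
pose k := 2 * (`|L| * l).
pose r (p : R * R) := expR (k * (1 - p.1)).
suff e0 : forall p, D p -> e p <= 0.
  apply/eqP; rewrite -subr_eq0 -normr_le0.
  by apply: (e0 (x1, t1)); split; rewrite //= /d addrC subrK.
have l0 := slowness_bound_ge0 slu.
have k0 : 0 <= k by rewrite !mulr_ge0.
have /bounded_onP[M1 wM] := bw t1.
have /bounded_onP[M2 whM] := bwh t1.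
have M0 : 0 <= `|M2| + `|M1| by rewrite addr_ge0.
apply: (@halving_le0 _ _ D e r _ M0).
  move=> [x t] Dxt; have [/= xP _ tt1] := Dxt.
  have t0 := Dgt0 _ _ Dxt.
  have pt0 := past_time_ge0 xP (Dge _ _ Dxt).
  have ptt : past_time lu t x <= t.
    move/andP : xP => [x0 x1'].
    by rewrite gerBl (transit_ge0 slu).
  apply: (@le_trans _ _ (`|M2| + `|M1|)).
    apply: (le_trans (ler_normB _ _)); apply: lerD.
      apply: le_trans (ler_norm _); apply: (whM (x, t)).
      by split; rewrite /= in_itv//= ltW.
    apply: le_trans (ler_norm _); apply: (wM (x, past_time lu t x)).
    by split; rewrite /= in_itv//= pt0 (le_trans ptt).
  rewrite ler_peMr// /r -[leLHS]expR0 ler_expR mulr_ge0// subr_ge0.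
  by move/andP : xP => [].
(* Both components have the same value at [x = 1] as the delayed state, so only
   the source integrals differ. *)
move=> A A0 eA [x t] Dxt; have [/= xP xtd tt1] := Dxt.
have /andP[x0 xle1] := xP.
have t0 := Dgt0 _ _ Dxt; have xt := Dge _ _ Dxt.
have t0' := ltW t0.
have xt0 : 0 <= t - transit mh x 1 by rewrite subr_ge0.
rewrite /e [leLHS]prod_normE/= ge_max; apply/andP; split.
- have uxt : transit lu x 1 <= t.
    apply: le_trans xt; rewrite (transit_muhat slu slv)// lerDl.
    exact: transit_ge0 slv _ _.
  have [iG1 ->] := ou x t xP t0.
  have [iG2 ->] := rightward_past bu xP uxt.
  have [-> _] := obc t t0'; have [_ _ ->] := bc t t0'.
  rewrite distrC opprB addrC addrA subrK.
  apply: (source_integral_contraction FL slu normB_fst_le xP A0 iG1 iG2).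
  move=> s /andP[xs s1]; apply: (eA (s, t)).
  split=> //=; first by rewrite (le_trans x0 xs).
  apply: le_trans xtd; rewrite lerD2r (transit_mh_split x0 xs s1)// lerDr.
  exact: transit_mh_ge0.
- have [iG1 ->] := leftward_observer ov xP xt.
  have [iG2 ->] := leftward_past bv xP xt.
  have [_ ->] := obc _ xt0; have [_ -> _] := bc _ xt0.
  rewrite opprD addrACA subrr add0r.
  apply: (source_integral_contraction FL slv normB_snd_le xP A0 iG1 iG2).
  move=> s /andP[xs s1]; apply: (eA (s, t - transit mh x s)).
  split=> /=; first by rewrite (le_trans x0 xs).
    by rewrite lerBrDl addrA -(transit_mh_split x0 xs s1).
  by apply: le_trans tt1; rewrite gerBl; exact: transit_mh_ge0.
Qed.

End Tracking.

(** * Finite-time convergence of the observer *)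

Theorem theorem13 (R : realType) (n : nat) (lu lv : R -> R)
    (F : R -> R * R -> R * R)
    (f0 : 'rV[R]_n -> R -> R -> 'rV[R]_n) (g0 : 'rV[R]_n -> R -> R -> R)
    (h : 'rV[R]_n -> R -> R -> R -> 'rV[R]_n)
    (hS1 : admissible_speeds lu lv)
    (hS2 : lipschitz_data F f0 g0)
    (hS3 : zero_equilibrium F f0 g0)
    (hS4 : stabilizable f0)
    (hO : ode_observer f0 g0 h) :
  exists2 T : R, 0 < T &
    forall (U Y : R -> R) (what0 : R -> R * R) (Xhat0 : 'rV[R]_n)
           (w0 : R -> R * R) (X0 : 'rV[R]_n)
           (w what : R -> R -> R * R) (X Xhat : R -> 'rV[R]_n),
      Linf_signal 0 U -> Linf_signal 0 Y ->
      Linf_profile w0 -> Linf_profile what0 ->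
      system_solution lu lv F f0 g0 w0 X0 U Y w X ->
      observer_solution lu lv F h what0 Xhat0 U Y what Xhat ->
      forall t, T <= t ->
        (forall x, 0 <= x <= 1 -> what x t = delayed_state lu w x t) /\
        Xhat t = delayed_ode lu X t.
Proof.
have [mlu mlv lpos [l lmax]] := hS1.
have slu : slowness_bounded l lu.
  split=> // x x01; have [lux _] := lpos x x01; split=> //.
  by apply: le_trans (lmax x x01); rewrite le_max lexx.
have slv : slowness_bounded l lv.
  split=> // x x01; have [_ lvx] := lpos x x01; split=> //.
  by apply: le_trans (lmax x x01); rewrite le_max lexx orbT.
pose tu := transit lu 0 1.
(* [t0 + tu] is [1] more than the critical time [transit muhat 0 1], so from
   then on the whole profile is tracked; in plant time at [x = 0] it is [t0]. *)
pose t0 := transit lv 0 1 + 1.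
have tu0 : 0 <= tu by exact: transit_ge0 slu _ _.
have t00 : 0 < t0 by rewrite ltr_wpDl//; exact: transit_ge0 slv _ _.
have [d d0 obs] := hO t0 (ltW t00).
exists (t0 + d + tu); first by rewrite ltr_wpDr// ltr_wpDr.
move=> U Y what0 Xhat0 w0 X0 w what X Xhat _ _ _ _ sys osys.
have [FL _ _] := hS2.
have track x t : 0 <= x <= 1 -> t0 + tu <= t ->
    what x t = delayed_state lu w x t.
  move=> x01 tt; apply: (observer_state_eq slu slv FL sys osys x01).
  have /andP[x0 x1] := x01.
  apply: lt_le_trans tt.
  have := transit_mh_split slu slv (lexx 0) x0 x1 (lexx 1).
  rewrite (transit_muhat slu slv (lexx 0) (lexx 1)) => E.
  have := transit_mh_ge0 slu slv (lexx 0) x1.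
  by rewrite /t0 /tu; lra.
move=> t Tt; split=> [x x01|].
  by apply: track => //; apply: le_trans Tt; lra.
have [Lw _ odeX bc _] := sys.
have [_ _ odeXh _ _] := osys.
have past s : past_time lu (s + tu) 0 = s by rewrite /past_time addrK.
have odeXh' : ode_solution t0 (fun s Z => h Z (w 0 s).1 (w 0 s).2 s)
    (fun s => Xhat (s + tu)).
  have := ode_solution_restart _ odeXh.
  move=> /(_ (t0 + tu)) /(_ (addr_ge0 (ltW t00) tu0)) /ode_solution_shift.
  apply: eq_ode_solution => s t0s.
  by rewrite past track ?lexx ?ler01 ?lerD2r// /delayed_state past.
have -> : Xhat t = Xhat ((t - tu) + tu) by rewrite subrK.
rewrite (obs (fun s => (w 0 s).1) (fun s => (w 0 s).2) X _ _ _ _ odeXh')//.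
- by apply: Linf_signal_trace => //; [rewrite lexx ler01|exact: ltW].
- exact: ode_solution_restart (ltW t00) odeX.
- by move=> s t0s; have [] := bc s (le_trans (ltW t00) t0s).
- by rewrite lerBrDr.
Qed.
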